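(* Let $A$ be an associative ring with identity, let $E$ be an $A$-bimodule, and let $R:=A\propto E$ be the trivial ring extension of $A$ by $E$. Then $R$ is nil-good if and only if $A$ is nil-good.
   Context: The trivial ring extension $A\propto E$ is the set of pairs $(a,e)$, $a\in A$, $e\in E$, with componentwise addition and multiplication $(a,e)(b,f)=(ab,af+eb)$. If $A$ is commutative, an $A$-module is regarded as a bimodule with $eb=be$. A ring is nil-good if each of its elements is either nilpotent or a sum of a unit and a nilpotent. *)

(* Defs.v *)
From HB Require Import structures.
From mathcomp Require Import all_boot all_order all_algebra.

Set Implicit Arguments.
Unset Strict Implicit.
Unset Printing Implicit Defensive.

Import GRing.Theory.
Local Open Scope ring_scope.

(* The left action is the scaling [a *: e] of the underlying left module;
   the right action [e * a] is written [rscale e a].  All modules are unital.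
   The base is a [pzRingType], so the zero ring is allowed. *)
HB.mixin Record Lmodule_isBimodule (A : pzRingType) E of GRing.Lmodule A E := {
  rscale : E -> A -> E;
  rscalerA : forall e a b, rscale (rscale e a) b = rscale e (a * b);
  rscaler1 : forall e, rscale e 1 = e;
  rscalerDl : forall a, {morph rscale^~ a : e f / e + f};
  rscalerDr : forall e, {morph rscale e : a b / a + b};
  scale_rscaleA : forall a e b, a *: rscale e b = rscale (a *: e) b
}.

#[short(type="bimodType")]
HB.structure Definition Bimodule (A : pzRingType) :=
  {E of Lmodule_isBimodule A E & GRing.Lmodule A E}.

(* An alias of [A * E], so that its ring structure does not interfere with the
   componentwise product of rings; addition is inherited from [A * E]. *)
Definition trivext (A : pzRingType) (E : bimodType A) : Type := (A * E)%type.

Section TrivialExtension.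
Variables (A : pzRingType) (E : bimodType A).

HB.instance Definition _ := GRing.Zmodule.copy (trivext E) (A * E)%type.

Implicit Types x y z : trivext E.

Definition trivext_one : trivext E := (1, 0).

Definition trivext_mul x y : trivext E :=
  (x.1 * y.1, x.1 *: y.2 + rscale x.2 y.1).

Fact rscale0r (a : A) : rscale (0 : E) a = 0.
Proof. by apply: (addIr (rscale (0 : E) a)); rewrite -rscalerDl !add0r. Qed.

Fact trivext_mulA : associative trivext_mul.
Proof.
move=> x y z; congr (_, _); rewrite /= ?mulrA //.
by rewrite scalerDr rscalerDl scalerA rscalerA scale_rscaleA addrA.
Qed.

Fact trivext_mul1l : left_id trivext_one trivext_mul.
Proof.
by case=> a e; congr (_, _); rewrite /= ?mul1r // scale1r rscale0r addr0.
Qed.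

Fact trivext_mul1r : right_id trivext_one trivext_mul.
Proof.
by case=> a e; congr (_, _); rewrite /= ?mulr1 // scaler0 rscaler1 add0r.
Qed.

Fact trivext_mulDl : left_distributive trivext_mul +%R.
Proof.
move=> x y z; congr (_, _); rewrite /= ?mulrDl //.
by rewrite scalerDl rscalerDl addrACA.
Qed.

Fact trivext_mulDr : right_distributive trivext_mul +%R.
Proof.
move=> x y z; congr (_, _); rewrite /= ?mulrDr //.
by rewrite scalerDr rscalerDr addrACA.
Qed.

HB.instance Definition _ := GRing.Zmodule_isPzRing.Build (trivext E)
  trivext_mulA trivext_mul1l trivext_mul1r trivext_mulDl trivext_mulDr.

End TrivialExtension.

Definition nilpotent_elt (R : pzRingType) (x : R) : Prop :=
  exists n : nat, x ^+ n = 0.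

(* Two-sided invertibility; [GRing.unit] is not available as it requires a
   [unitRingType], i.e. a decidable unit predicate. *)
Definition unit_elt (R : pzRingType) (u : R) : Prop :=
  exists v : R, u * v = 1 /\ v * u = 1.

Definition nil_good (R : pzRingType) : Prop :=
  forall x : R, nilpotent_elt x \/
    exists u t : R, [/\ unit_elt u, nilpotent_elt t & x = u + t].

(* Main.v *)
Require Import Defs.
From HB Require Import structures.
From mathcomp Require Import all_boot all_order all_algebra.

(** The projection of the trivial extension onto [A] is a surjective ring
    morphism whose kernel [0 * E] squares to zero.  Surjective morphisms carry
    nil-goodness forward, since they preserve units and nilpotents.  In the
    other direction, units and nilpotents both lift along a square-zero kernel:
    [x] is a unit, resp. nilpotent, as soon as its first component is
    ([unit_trivext], [nilpotent_trivext]).  So whatever [A] says about [x.1]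
    holds for [x], after splitting [x.1 = u + t] as [x = (u, x.2) + (t, 0)]. *)

Import GRing.Theory.
Local Open Scope ring_scope.

Lemma nilpotent_rmorph (R S : pzRingType) (f : {rmorphism R -> S}) (x : R) :
  nilpotent_elt x -> nilpotent_elt (f x).
Proof. by case=> n xn0; exists n; rewrite -rmorphXn xn0 rmorph0. Qed.

Lemma unit_rmorph (R S : pzRingType) (f : {rmorphism R -> S}) (u : R) :
  unit_elt u -> unit_elt (f u).
Proof.
by case=> v [uv1 vu1]; exists (f v); rewrite -!rmorphM uv1 vu1 rmorph1.
Qed.

Lemma nil_good_rmorph (R S : pzRingType) (f : {rmorphism R -> S}) :
  (forall y, exists x, f x = y) -> nil_good R -> nil_good S.
Proof.
move=> f_surj goodR y; have [x <-] := f_surj y.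
have [nilx | [u [t [unitu nilt ->]]]] := goodR x.
  by left; apply: nilpotent_rmorph.
right; exists (f u), (f t); split; last exact: rmorphD.
- exact: unit_rmorph.
- exact: nilpotent_rmorph.
Qed.

Section TrivialExtensionLifting.
Variables (A : pzRingType) (E : bimodType A).

Definition trivext_proj (x : trivext E) : A := x.1.

Fact trivext_proj_is_zmod_morphism : zmod_morphism trivext_proj.
Proof. by []. Qed.

Fact trivext_proj_is_monoid_morphism : monoid_morphism trivext_proj.
Proof. by []. Qed.

HB.instance Definition _ := GRing.isZmodMorphism.Build (trivext E) A
  trivext_proj trivext_proj_is_zmod_morphism.
HB.instance Definition _ := GRing.isMonoidMorphism.Build (trivext E) A
  trivext_proj trivext_proj_is_monoid_morphism.

Lemma trivext_ker_sqr0 (x : trivext E) : trivext_proj x = 0 -> x ^+ 2 = 0.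
Proof.
case: x => a e; rewrite /trivext_proj /= => ->.
rewrite expr2; congr (_, _); rewrite /= ?mul0r // scale0r add0r.
by apply: (addIr (rscale e 0)); rewrite -rscalerDr !add0r.
Qed.

(** If the first component dies at the power [n], then [x ^+ n] lies in the
    square-zero kernel, so [x] dies at the power [2 * n]. *)
Lemma nilpotent_trivext (x : trivext E) :
  nilpotent_elt (trivext_proj x) -> nilpotent_elt x.
Proof.
case=> n xn0; exists (n * 2)%N; rewrite exprM.
by apply: trivext_ker_sqr0; rewrite rmorphXn.
Qed.

Lemma rscaleNl (e : E) (a : A) : rscale (- e) a = - rscale e a.
Proof.
by apply: (addIr (rscale e a)); rewrite -rscalerDl !addNr rscale0r.
Qed.

(** The second component [f] of the inverse is forced by [a f + e b = 0]:
    it is [- b e b] when [b] is the inverse of [a]. *)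
Lemma unit_trivext (x : trivext E) :
  unit_elt (trivext_proj x) -> unit_elt x.
Proof.
case: x => a e [b] /= []; rewrite /trivext_proj /= => ab1 ba1.
exists ((b, - (b *: rscale e b)) : trivext E); split.
- congr (_, _); rewrite /= ?ab1 //.
  by rewrite scalerN scalerA ab1 scale1r addNr.
- congr (_, _); rewrite /= ?ba1 //.
  by rewrite rscaleNl -scale_rscaleA rscalerA ba1 rscaler1 addrN.
Qed.

End TrivialExtensionLifting.

Theorem theorem4p2 (A : pzRingType) (E : bimodType A) :
  nil_good (trivext E) <-> nil_good A.
Proof.
split=> [|goodA].
  apply: (nil_good_rmorph _ _ (trivext_proj A E)) => a.
  by exists ((a, 0) : trivext E).
case=> a e; have [nila | [u [t [unitu nilt ->]]]] := goodA a.
  by left; apply: nilpotent_trivext.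
right; exists ((u, e) : trivext E), ((t, 0) : trivext E); split.
- exact: unit_trivext.
- exact: nilpotent_trivext.
- by congr (_, _); rewrite /= addr0.
Qed.
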